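(* Let $n\ge 3$ be an integer. There exists no hypergraph $\mathcal H=(\mathcal V,\mathcal E)$ with $|\mathcal E|=n$ such that $\omega_0(\mathcal H)=\frac{n(n+1)}{2}-1$.
   Context: A hypergraph is a pair $\mathcal H=(\mathcal V,\mathcal E)$ where $\mathcal V$ is a finite set (vertices) and $\mathcal E$ is a collection of (pairwise distinct) nonempty subsets of $\mathcal V$ (hyperedges). An edge-discriminator on $\mathcal H$ is a function $\lambda:\mathcal V\to\mathbb Z^{+}\cup\{0\}$ such that $\sum_{v\in E}\lambda(v)>0$ for every $E\in\mathcal E$, and $\sum_{v\in E}\lambda(v)\ne\sum_{v\in E'}\lambda(v)$ for every two distinct $E,E'\in\mathcal E$. Its weight is $\omega_\lambda(\mathcal V)=\sum_{v\in\mathcal V}\lambda(v)$. The quantity $\omega_0(\mathcal H)$, the weight of an optimal edge-discriminator on $\mathcal H$, is the minimum of $\omega_\lambda(\mathcal V)$ over all edge-discriminators $\lambda$ on $\mathcal H$. *)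

(* Defs.v *)
From mathcomp Require Import all_boot.
Set Implicit Arguments.
Unset Strict Implicit.
Unset Printing Implicit Defensive.

Record hypergraph := Hypergraph {
  vertex :> finType;
  edges : {set {set vertex}};
  edges_nonempty : set0 \notin edges
}.

Definition set_weight (V : finType) (lambda : V -> nat) (A : {set V}) : nat :=
  \sum_(v in A) lambda v.

Definition edge_discriminator (H : hypergraph) (lambda : H -> nat) : bool :=
  [forall E in edges H, 0 < set_weight lambda E] &&
  [forall E in edges H, forall E' in edges H,
     (E != E') ==> (set_weight lambda E != set_weight lambda E')].

Definition weight (H : hypergraph) (lambda : H -> nat) : nat :=
  set_weight lambda [set: H].

(* A function of weight w only takes values at most w, so searching the finite
   type {ffun H -> 'I_w.+1} loses nothing; see discriminator_weightP. *)
Definition discriminator_weight (H : hypergraph) (w : nat) : bool :=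
  [exists lambda : {ffun H -> 'I_w.+1},
     edge_discriminator (fun v : H => lambda v : nat) &&
     (weight (fun v : H => lambda v : nat) == w)].

Lemma eq_set_weight (V : finType) (l m : V -> nat) :
  l =1 m -> set_weight l =1 set_weight m.
Proof. by move=> elm A; apply: eq_bigr => v _; rewrite elm. Qed.

Lemma eq_edge_discriminator (H : hypergraph) (l m : H -> nat) :
  l =1 m -> edge_discriminator l = edge_discriminator m.
Proof.
move=> /eq_set_weight elm; rewrite /edge_discriminator; congr (_ && _).
  by apply: eq_forallb => E; rewrite elm.
apply: eq_forallb => E; congr (_ ==> _).
by apply: eq_forallb => E'; rewrite !elm.
Qed.

Lemma discriminator_weightP (H : hypergraph) (w : nat) :
  reflect (exists2 lambda : H -> nat,
             edge_discriminator lambda & weight lambda = w)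
          (discriminator_weight H w).
Proof.
apply: (iffP existsP) => [[l /andP[dl /eqP wl]] | [l dl wl]].
  by exists (fun v : H => l v : nat).
have lew v : l v < w.+1.
  by rewrite ltnS -wl /weight /set_weight (bigD1 v) ?inE //= leq_addr.
pose m : {ffun H -> 'I_w.+1} := [ffun v => Ordinal (lew v)].
have eml : (fun v => m v : nat) =1 l by move=> v; rewrite ffunE.
exists m; rewrite (eq_edge_discriminator eml) dl /=.
by rewrite /weight (eq_set_weight eml); apply/eqP.
Qed.

Lemma sum_bits_lt n (p : pred nat) : \sum_(i < n) p i * 2 ^ i < 2 ^ n.
Proof.
elim: n => [|n IHn]; first by rewrite big_ord0.
rewrite big_ord_recr /= expnS mul2n -addnn -addSn leq_add //.
by case: (p n); rewrite ?mul1n.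
Qed.

Lemma sum_bits_inj n (p q : pred nat) :
  \sum_(i < n) p i * 2 ^ i = \sum_(i < n) q i * 2 ^ i ->
  forall i, i < n -> p i = q i.
Proof.
elim: n => [|n IHn] // ; rewrite !big_ord_recr /= => epq.
have top : p n = q n.
  move: epq (sum_bits_lt n p) (sum_bits_lt n q).
  case: (p n); case: (q n) => //; rewrite mul1n mul0n addn0.
    by move=> <- _; rewrite ltnNge leq_addl.
  by move=> ->; rewrite ltnNge leq_addl.
move=> i; rewrite ltnS leq_eqVlt => /predU1P[-> //|].
by apply: IHn; move: epq; rewrite top => /addIn.
Qed.

Lemma edge_discriminator_ex (H : hypergraph) :
  exists lambda : H -> nat, edge_discriminator lambda.
Proof.
pose l (v : H) := 2 ^ enum_rank v; exists l.
pose bit (E : {set H}) (i : nat) := [exists v in E, enum_rank v == i :> nat].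
have bitE E (v : H) : bit E (enum_rank v) = (v \in E).
  apply/existsP/idP => [[u /andP[uE /eqP/val_inj/enum_rank_inj <-]] //|vE].
  by exists v; rewrite vE /=.
have sE E : set_weight l E = \sum_(i < #|H|) bit E i * 2 ^ i.
  rewrite (reindex (@enum_rank H)) /=; last exact: onW_bij (@enum_rank_bij H).
  rewrite /set_weight big_mkcond; apply: eq_bigr => v _.
  by rewrite bitE; case: (v \in E); rewrite ?mul1n.
apply/andP; split; apply/forall_inP => E EH.
  have /set0Pn[v vE] : E != set0.
    by apply: contraNneq (edges_nonempty H) => <-.
  by rewrite /set_weight (bigD1 v) //= addn_gt0 expn_gt0.
apply/forall_inP => E' _; apply/implyP; apply: contraNneq.
rewrite !sE => /sum_bits_inj ebit; apply/eqP/setP => v.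
by rewrite -!bitE; apply: ebit.
Qed.

Lemma discriminator_weight_ex (H : hypergraph) :
  exists w, discriminator_weight H w.
Proof.
have [l dl] := edge_discriminator_ex H.
by exists (weight l); apply/discriminator_weightP; exists l.
Qed.

Definition omega0 (H : hypergraph) : nat := ex_minn (discriminator_weight_ex H).

Lemma omega0_attained (H : hypergraph) :
  exists2 lambda : H -> nat,
    edge_discriminator lambda & weight lambda = omega0 H.
Proof. by rewrite /omega0; case: ex_minnP => w /discriminator_weightP. Qed.

Lemma omega0_min (H : hypergraph) (lambda : H -> nat) :
  edge_discriminator lambda -> omega0 H <= weight lambda.
Proof.
move=> dl; rewrite /omega0; case: ex_minnP => w _; apply.
by apply/discriminator_weightP; exists lambda.
Qed.

(* Main.v *)
(** Assign values to the vertices one at a time.  Among the n + 1 sets consisting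
    of the hyperedges and the empty set, charge each pair to the last vertex at
    which its two members differ; a vertex charged with c pairs has at most c
    forbidden values, so some value at most c is free, which gives
    omega0 <= n(n+1)/2.  If the hyperedges are pairwise disjoint, their weights
    are distinct and positive, so omega0 >= n(n+1)/2.  Otherwise 2 can be saved:
    among the pairs (X, set0) charged to the last vertex at most one forbids a
    nonnegative value, which settles a vertex of degree at least 3, and two
    vertices of degree at least 2 lying in incomparable families of hyperedges
    when they are placed last.  In the remaining case exactly two hyperedges
    A and A' meet, and one starts by giving the weights 3, 2, 1 to A, A' and a
    third hyperedge at total cost 4 for the 6 pairs settled. *)

Require Import Defs.
From mathcomp Require Import all_boot zify.

Set Implicit Arguments.
Unset Strict Implicit.
Unset Printing Implicit Defensive.

(** * Vertex-by-vertex assignment and the pairs of sets it settles *)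

Definition upd (V : finType) (l : V -> nat) (v : V) (t : nat) (x : V) : nat :=
  if x == v then t else l x.

(** [S] is the set of vertices already placed, so this is the weight [X] has received so far. *)
Definition wt (V : finType) (l : V -> nat) (S X : {set V}) : nat :=
  set_weight l (X :&: S).

(* Pairs are ordered here, so each unordered pair is counted twice. *)
Definition settled (V : finType) (F : {set {set V}}) (S : {set V}) :
    {set {set V} * {set V}} :=
  [set p in setX F F | (p.1 != p.2) && (p.1 :\: S == p.2 :\: S)].

(* Each unordered pair is counted once, its member containing [v] coming first. *)
Definition charged (V : finType) (F : {set {set V}}) (S : {set V}) (v : V) :
    {set {set V} * {set V}} :=
  [set p in setX F F |
    [&& v \in p.1, v \notin p.2 & p.1 :\: (v |: S) == p.2 :\: (v |: S)]].

Definition separates (V : finType) (F : {set {set V}}) (S : {set V})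
    (l : V -> nat) : Prop :=
  forall X Y, (X, Y) \in settled F S -> wt l S X <> wt l S Y.

(* [l] is at least [s] cheaper on [S] than the number of unordered pairs settled
   by [S]; both sides are doubled. *)
Definition saves (V : finType) (F : {set {set V}}) (S : {set V})
    (l : V -> nat) (s : nat) : Prop :=
  separates F S l /\ 2 * (set_weight l S + s) <= #|settled F S|.

Lemma wt_updU1 (V : finType) (l : V -> nat) (S X : {set V}) (v : V) (t : nat) :
  v \notin S -> wt (upd l v t) (v |: S) X = (v \in X) * t + wt l S X.
Proof.
move=> vS; rewrite /wt /set_weight.
have eqS : \sum_(x in X :&: S) upd l v t x = \sum_(x in X :&: S) l x.
  apply: eq_bigr => x; rewrite inE => /andP[_ xS]; rewrite /upd.
  by case: eqP => // exv; rewrite -exv xS in vS.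
case vX: (v \in X).
  have -> : X :&: (v |: S) = v |: (X :&: S).
    by apply/setP => x; rewrite !inE; case: eqP => [->|//]; rewrite vX.
  by rewrite big_setU1 ?inE ?(negPf vS) ?andbF //= eqS /upd eqxx mul1n.
have -> : X :&: (v |: S) = X :&: S.
  by apply/setP => x; rewrite !inE; case: eqP => [->|//]; rewrite vX.
by rewrite eqS.
Qed.

Lemma weight_updU1 (V : finType) (l : V -> nat) (S : {set V}) (v : V) (t : nat) :
  v \notin S -> set_weight (upd l v t) (v |: S) = t + set_weight l S.
Proof.
move=> vS; have := wt_updU1 l setT t vS.
by rewrite /wt !setTI inE mul1n.
Qed.

Lemma setDU1_eq (V : finType) (S X Y : {set V}) (v : V) :
  (v \in X) = (v \in Y) -> X :\: (v |: S) = Y :\: (v |: S) -> X :\: S = Y :\: S.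
Proof.
move=> eqv /setP eXY; apply/setP => x; have := eXY x; rewrite !inE.
by case: (eqVneq x v) => [->|//]; rewrite eqv.
Qed.

(** The members of a pair settled by [S] agree at [v], since [v] is not in [S]. So the old pairs,
    the charged pairs and their swaps are disjoint families, all settled once [v] joins [S]. *)
Lemma card_settledU1 (V : finType) (F : {set {set V}}) (S : {set V}) (v : V) :
  v \notin S ->
  #|settled F S| + 2 * #|charged F S v| <= #|settled F (v |: S)|.
Proof.
move=> vS; pose swap (p : {set V} * {set V}) := (p.2, p.1).
have swapK : involutive swap by case.
have <- : #|charged F S v| + #|swap @: charged F S v| = 2 * #|charged F S v|.
  by rewrite card_imset ?mul2n ?addnn //; apply: inv_inj.
have eqS X Y : X :\: S = Y :\: S -> (v \in X) = (v \in Y).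
  by move=> /setP/(_ v); rewrite !inE vS.
have eqU X Y : X :\: S = Y :\: S -> X :\: (v |: S) = Y :\: (v |: S).
  by move=> eXY; rewrite setUC -!setDDl eXY.
rewrite addnA -cardsUI -[X in X + _]addn0.
have sw X Y : ((X, Y) \in swap @: charged F S v) = ((Y, X) \in charged F S v).
  by rewrite -[(X, Y)](swapK (X,Y)) mem_imset //; apply: inv_inj.
have -> : settled F S :&: charged F S v = set0.
  apply/setP => -[X Y]; rewrite !inE /=; apply/negP.
  move=> /andP[/andP[_ /andP[_ /eqP/eqS e]] /andP[_ /and3P[vX]]].
  by rewrite -e vX.
rewrite cards0 addn0 addn0 -cardsUI.
have -> : (settled F S :|: charged F S v) :&: swap @: charged F S v = set0.
  apply/setP => -[X Y]; rewrite in_setI sw !inE /=; apply/negP.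
  case/andP=> /orP[]; last first.
    by move=> /andP[_ /and3P[vX _ _]] /andP[_ /and3P[_ /negP[]]].
  move=> /andP[_ /andP[_ /eqP/eqS e]] /andP[_ /and3P[vX]].
  by rewrite e vX.
rewrite cards0 addn0; apply/subset_leq_card/subsetP => -[X Y].
rewrite in_setU sw in_setU -orbA !inE /= => /or3P[].
- case/andP=> /andP[-> ->] /andP[-> /eqP/eqU ->].
  by rewrite eqxx.
- case/andP=> /andP[-> ->] /and3P[vX vY ->] /=; rewrite andbT.
  by apply: contraNneq vY => <-.
case/andP=> /andP[-> ->] /and3P[vX vY /eqP ->] /=; rewrite eqxx andbT.
by apply: contraNneq vY => ->.
Qed.

(** * Choosing the value of the next vertex *)

Lemma avoid_pos (T : finType) (Q : {set T}) (f : T -> nat) :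
  exists t, [/\ 0 < t, t <= #|Q|.+1 & forall q, q \in Q -> f q <> t].
Proof.
have [/allP all_hit | /allPn[t]] :=
  boolP (all (mem [seq f q | q <- enum Q]) (iota 1 #|Q|.+1)).
  have := uniq_leq_size (iota_uniq _ _) all_hit.
  by rewrite size_iota size_map -cardE ltnn.
rewrite mem_iota => /andP[t0 tQ] /negP ft; exists t; split=> // q qQ fq.
by apply: ft; apply/mapP; exists q; rewrite ?mem_enum.
Qed.

(** The value [t] at [v] confuses a charged pair [(X, Y)] only if [t + wt l S X = wt l S Y]; for
    these pairs no positive [t] does. *)
Definition nonneg_gap (V : finType) (F : {set {set V}}) (S : {set V})
    (l : V -> nat) (v : V) : {set {set V} * {set V}} :=
  [set p in charged F S v | wt l S p.2 <= wt l S p.1].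

Lemma nonneg_gapE (V : finType) (F : {set {set V}}) (S X Y : {set V})
    (l : V -> nat) (v : V) :
  ((X, Y) \in nonneg_gap F S l v) =
  ((X, Y) \in charged F S v) && (wt l S Y <= wt l S X).
Proof. by rewrite inE. Qed.

(** If [X] and [Y] agree at [v], the pair was already settled by [S] and both weights grow equally,
    so only charged pairs restrict [t]. *)
Lemma separates_upd (V : finType) (F : {set {set V}}) (S : {set V})
    (l : V -> nat) (v : V) (t : nat) :
  separates F S l -> v \notin S ->
  (forall X Y, (X, Y) \in charged F S v -> t + wt l S X <> wt l S Y) ->
  separates F (v |: S) (upd l v t).
Proof.
move=> sep vS ch X Y; rewrite !inE /= => /andP[/andP[XF YF] /andP[nXY /eqP eXY]].
rewrite !wt_updU1 //.
case vX: (v \in X); case vY: (v \in Y); rewrite ?mul1n ?mul0n ?add0n.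
- move=> /addnI; apply: sep; rewrite !inE /= XF YF nXY.
  by apply/eqP/(setDU1_eq _ eXY); rewrite vX.
- by apply: ch; rewrite !inE /= XF YF vX vY eXY /=.
- by move=> /esym; apply: ch; rewrite !inE /= XF YF vX vY eXY /=.
apply: sep; rewrite !inE /= XF YF nXY.
by apply/eqP/(setDU1_eq _ eXY); rewrite vX.
Qed.

(* Pairs of [nonneg_gap] forbid at most the value 0, so either 0 is free or some
   positive value up to one more than the number of the other pairs is. *)
Lemma separates_step (V : finType) (F : {set {set V}}) (S : {set V})
    (l : V -> nat) (v : V) :
  separates F S l -> v \notin S ->
  exists2 t, separates F (v |: S) (upd l v t) &
    t = 0 \/ [/\ 0 < t, t + #|nonneg_gap F S l v| <= #|charged F S v|.+1 &
      exists2 p, p \in charged F S v & wt l S p.1 = wt l S p.2].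
Proof.
move=> sep vS.
have [/existsP[p /andP[pP /eqP ep]] | /existsPn no0] :=
  boolP [exists p in charged F S v, wt l S p.1 == wt l S p.2]; last first.
  exists 0; last by left.
  apply: separates_upd => // X Y XYP e; have := no0 (X, Y).
  by rewrite XYP -e eqxx.
(* Outside [nonneg_gap] the truncated difference is the true one. *)
have [t [t0 tQ tf]] := avoid_pos (charged F S v :\: nonneg_gap F S l v)
  (fun p => wt l S p.2 - wt l S p.1).
exists t; last first.
  right; split=> //; last by exists p.
  have sub : nonneg_gap F S l v \subset charged F S v.
    by apply/subsetP => q; rewrite inE => /andP[].
  by rewrite -(cardsID (nonneg_gap F S l v) (charged F S v)) (setIidPr sub); lia.
apply: separates_upd => // X Y XYP e; apply: (tf (X, Y)); last by rewrite /= -e addnK.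
by rewrite inE XYP inE XYP /= -e andbT -ltnNge; lia.
Qed.

Lemma saves_upd (V : finType) (F : {set {set V}}) (S : {set V})
    (l : V -> nat) (v : V) (s t k : nat) :
  saves F S l s -> v \notin S -> separates F (v |: S) (upd l v t) ->
  t + k <= #|charged F S v| -> saves F (v |: S) (upd l v t) (s + k).
Proof.
move=> [_ ls] vS sep tk; split=> //; rewrite weight_updU1 //.
by have := card_settledU1 F vS; lia.
Qed.

(** If 0 is free, all charged pairs are saved; otherwise the bound of [separates_step] saves all of
    [nonneg_gap] but one. *)
Lemma saves_step (V : finType) (F : {set {set V}}) (S : {set V})
    (l : V -> nat) (v : V) (s : nat) (Q : {set {set V} * {set V}}) :
  saves F S l s -> v \notin S -> Q \subset nonneg_gap F S l v ->
  exists l', saves F (v |: S) l' (s + #|Q|.-1).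
Proof.
move=> sl vS QS; have [t sept ht] := separates_step sl.1 vS.
exists (upd l v t); apply: saves_upd => //.
have := subset_leq_card QS.
have : #|nonneg_gap F S l v| <= #|charged F S v|.
  by apply/subset_leq_card/subsetP => q; rewrite inE => /andP[].
case: ht => [->|[t0 tU [p pP ep]]]; first by lia.
suff : 0 < #|nonneg_gap F S l v| by lia.
by apply/card_gt0P; exists p; rewrite inE pP ep /=.
Qed.

(** A pair that forbids 0 has equal weights, so it lies in [nonneg_gap] outside [Q] and absorbs the
    loss of one. *)
Lemma saves_step_strict (V : finType) (F : {set {set V}}) (S : {set V})
    (l : V -> nat) (v : V) (s : nat) (Q : {set {set V} * {set V}}) :
  saves F S l s -> v \notin S -> Q \subset charged F S v ->
  (forall p, p \in Q -> wt l S p.2 < wt l S p.1) ->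
  exists l', saves F (v |: S) l' (s + #|Q|).
Proof.
move=> sl vS QS Qlt; have [t sept ht] := separates_step sl.1 vS.
exists (upd l v t); apply: saves_upd => //.
case: ht => [->|[t0 tU [p pP ep]]]; first exact: subset_leq_card.
have pQ : p \notin Q by apply/negP => /Qlt; rewrite ep ltnn.
have : #|p |: Q| <= #|nonneg_gap F S l v|.
  apply/subset_leq_card/subsetP => q; rewrite !inE.
  case/predU1P => [->|qQ]; first by rewrite !inE in pP *; rewrite pP ep /=.
  by have := subsetP QS q qQ; rewrite !inE => ->; rewrite ltnW ?Qlt.
by rewrite cardsU1 pQ; lia.
Qed.

(** * From partial assignments to an upper bound on [omega0] *)

Lemma saves_extend (V : finType) (F : {set {set V}}) (S S' : {set V})
    (l : V -> nat) (s : nat) :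
  saves F S l s -> S \subset S' -> exists l', saves F S' l' s.
Proof.
move: {2}#|S' :\: S| (erefl #|S' :\: S|) => n.
elim: n S l => [|n IHn] S l cS sl SS'.
  exists l; suff -> : S' = S by [].
  by apply/eqP; rewrite eqEsubset SS' andbT -setD_eq0 -cards_eq0 cS.
have /card_gt0P[v] : 0 < #|S' :\: S| by rewrite cS.
rewrite inE => /andP[vS vS'].
(* With [Q] empty, [#|Q|.-1] is 0: the saving is merely kept. *)
have [l' sl'] := saves_step (Q := set0) sl vS (sub0set _).
apply: (IHn (v |: S) l').
- move: cS; rewrite (cardsD1 v) inE vS vS' add1n setDDl setUC => -[<-].
  by apply: eq_card => x; rewrite !inE.
- by move: sl'; rewrite cards0 addn0.
by rewrite subUset sub1set vS'.
Qed.

Lemma saves_start (V : finType) (F : {set {set V}}) (S : {set V}) :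
  exists l, saves F S l 0.
Proof.
suff : saves F set0 (fun=> 0) 0 by move=> /saves_extend; apply; apply: sub0set.
split; last by rewrite /set_weight big_set0.
by move=> X Y; rewrite !inE !setD0 => /andP[_ /andP[/negPf ->]].
Qed.

Lemma card_distinct_pairs (T : finType) (G : {set T}) :
  #|[set p in setX G G | p.1 != p.2]| + #|G| = #|G| * #|G|.
Proof.
rewrite -cardsX -(cardsID [set p | p.1 != p.2] (setX G G)) setIdE; congr (_ + _).
have inj : injective (fun x : T => (x, x)) by move=> x y [].
rewrite -(card_imset _ inj); apply: eq_card => -[x y]; apply/imsetP/idP.
  by move=> [z zG [-> ->]]; rewrite !inE /= eqxx zG.
rewrite !inE /= negbK => /andP[/eqP <- /andP[xG _]].
by exists x.
Qed.

(** Separation from [set0] is positivity of the weights, and [setT] settles every ordered pair of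
    distinct sets. *)
Lemma omega0_saves (H : hypergraph) (l : H -> nat) (s : nat) :
  saves (set0 |: edges H) setT l s ->
  2 * (omega0 H + s) <= #|edges H| * #|edges H|.+1.
Proof.
move=> [sep ls].
have sepE X Y : X \in set0 |: edges H -> Y \in set0 |: edges H -> X != Y ->
    set_weight l X != set_weight l Y.
  move=> XF YF nXY; apply/eqP; have := sep X Y; rewrite /wt !setIT; apply.
  by rewrite inE in_setX XF YF /= nXY !setDT eqxx.
have dl : edge_discriminator l.
  apply/andP; split; apply/forall_inP => E EH.
    have w0 : set_weight l set0 = 0 by rewrite /set_weight big_set0.
    rewrite lt0n -w0; apply: sepE; rewrite ?inE ?eqxx ?EH ?orbT //.
    by apply: contraNneq (edges_nonempty H) => <-.
  apply/forall_inP => E' EH'; apply/implyP; apply: sepE; rewrite inE ?EH ?EH' orbT //.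
have := omega0_min dl; rewrite /weight.
have := card_distinct_pairs (set0 |: edges H).
have -> : [set p in setX (set0 |: edges H) (set0 |: edges H) | p.1 != p.2] =
    settled (set0 |: edges H) setT.
  by apply/setP => p; rewrite !inE !setDT eqxx andbT.
rewrite cardsU1 edges_nonempty /=; move: ls.
move: #|settled _ _| #|edges H| => c e; nia.
Qed.

(** * Configurations in which 2 can be saved *)

Lemma wt_set0 (V : finType) (l : V -> nat) (S : {set V}) : wt l S set0 = 0.
Proof. by rewrite /wt set0I /set_weight big_set0. Qed.

Lemma charged_last (V : finType) (F : {set {set V}}) (v : V) (X Y : {set V}) :
  X \in F -> Y \in F -> v \in X -> v \notin Y -> (X, Y) \in charged F (~: [set v]) v.
Proof. by move=> XF YF vX vY; rewrite !inE /= XF YF vX vY setUCr !setDT /=. Qed.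

Lemma saves_ge3 (V : finType) (F G : {set {set V}}) (v : V) :
  set0 \in F -> G \subset F -> (forall X, X \in G -> v \in X) -> 2 < #|G| ->
  exists l, saves F setT l 2.
Proof.
move=> F0 GF vG G3; have [l sl] := saves_start F (~: [set v]).
have [||l'] := saves_step (v := v) (Q := setX G [set set0]) sl.
- by rewrite !inE eqxx.
- apply/subsetP => -[X Y]; rewrite in_setX in_set1 => /andP[XG /eqP->].
  by rewrite inE charged_last ?wt_set0 ?inE ?vG //= (subsetP GF).
rewrite setUCr cardsX cards1 muln1 => -[sep le]; exists l'; split=> //.
by move: le G3; move: #|settled _ _| #|G| => c g; lia.
Qed.

(** [L] and [M] witness incomparability, [L'] and [M'] that both degrees are at least 2. The vertex
    [w] is placed next to last and [v] last. *)
Lemma saves_incomparable (V : finType) (F : {set {set V}}) (v w : V)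
    (L L' M M' : {set V}) :
  set0 \in F -> L \in F -> L' \in F -> M \in F -> M' \in F ->
  v \in L -> w \notin L -> v \in L' -> L' != L ->
  w \in M -> v \notin M -> w \in M' -> M' != M ->
  exists l, saves F setT l 2.
Proof.
move=> F0 LF L'F MF M'F vL wL vL' nL wM vM wM' nM.
have nvw : w != v by apply: contraNneq wL => ->.
pose S := ~: [set v; w]; pose S1 := ~: [set v].
have wS : w \notin S by rewrite !inE eqxx orbT.
have vS1 : v \notin S1 by rewrite !inE eqxx.
have eS1 : w |: S = S1.
  by apply/setP => x; rewrite !inE; case: (eqVneq x w) => [->|_]; rewrite ?nvw ?orbF.
have chw X Y : X \in F -> Y \in F -> w \in X -> w \notin Y ->
    (v \in X) = (v \in Y) -> (X, Y) \in charged F S w.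
  move=> XF YF wX wY eXY; rewrite !inE /= XF YF wX wY eS1 /=.
  by apply/eqP/setP => x; rewrite !inE negbK; case: eqP => [->|].
(* [M'] needs a partner avoiding [w] that agrees with it at [v], the only vertex still to be placed
   after [w]. *)
pose Y0 := if v \in M' then L else set0.
have Y0P : (M', Y0) \in charged F S w.
  by rewrite /Y0; case: ifP => vM'; apply: chw; rewrite ?inE ?vM' ?vL.
have M0P : (M, set0) \in charged F S w by apply: chw; rewrite ?inE ?(negPf vM).
have Q2 : #|[set (M, set0); (M', Y0)]| = 2.
  by rewrite cards2 xpair_eqE negb_and eq_sym nM.
have QP : [set (M, set0); (M', Y0)] \subset charged F S w.
  by rewrite subUset !sub1set M0P.
have [l sl] := saves_start F S.
have [t sept ht] := separates_step sl.1 wS.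
have st k : t + k <= #|charged F S w| -> saves F S1 (upd l w t) k.
  by move=> tk; have := saves_upd sl wS sept tk; rewrite eS1 add0n.
case: ht => [t0|[t0 tU _]].
  apply: (saves_extend (st 2 _) (subsetT _)).
  by rewrite t0 add0n -Q2 subset_leq_card.
(* Either [w] saves 1 and [v] saves 1, or [L] and [M'] already have positive
   weight when [v] is reached and [v] saves 2. *)
have [Yz|Ypos] := posnP (wt l S Y0).
  have QU : [set (M, set0); (M', Y0)] \subset nonneg_gap F S l w.
    by rewrite subUset !sub1set !nonneg_gapE M0P Y0P /= wt_set0 Yz.
  have [||l' sl'] := saves_step (Q := [set (L, set0); (L', set0)]) (st 1 _) vS1.
  - by rewrite -ltnS; apply: leq_trans tU; rewrite -addnS leq_add2l -Q2 subset_leq_card.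
  - by rewrite subUset !sub1set !nonneg_gapE !charged_last ?wt_set0 ?inE.
  exists l'; move: sl'; rewrite setUCr.
  by rewrite cards2 xpair_eqE negb_and eq_sym nL.
have vM' : v \in M'.
  by apply: contraTT Ypos => /negPf vM'; rewrite /Y0 vM' wt_set0.
rewrite /Y0 vM' in Ypos.
have [|||l' sl'] :=
  saves_step_strict (Q := [set (L, set0); (M', set0)]) (st 0 _) vS1.
- rewrite addn0 -ltnS; apply: leq_trans tU; rewrite -addn1 leq_add2l card_gt0.
  by apply/set0Pn; exists (M, set0); rewrite nonneg_gapE M0P wt_set0.
- by rewrite subUset !sub1set !charged_last ?inE.
- move=> p; rewrite !inE -eS1 => /orP[] /eqP-> /=; rewrite !wt_updU1 // ?(negPf wL) ?wM'.
    by rewrite inE wt_set0.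
  by rewrite inE wt_set0 mul1n ltn_addr.
exists l'; move: sl'; rewrite setUCr cards2 xpair_eqE negb_and.
by have -> : L != M' by apply: contraNneq wL => ->.
Qed.

Lemma sum_mem1 (V : finType) (X : {set V}) (v : V) :
  \sum_(x in X) (x == v) = (v \in X).
Proof.
rewrite big_mkcond (bigD1 v) //= eqxx big1 ?addn0; first by case: (v \in X).
by move=> x /negPf->; case: ifP.
Qed.

Lemma saves_two_overlapping (V : finType) (E : {set {set V}}) (v u b : V)
    (A A' B : {set V}) :
  set0 \notin E -> A \in E -> A' \in E -> B \in E ->
  v \in A -> v \in A' -> u \in A -> u \notin A' -> b \in B ->
  B != A -> B != A' ->
  (forall X Y x, X \in E -> Y \in E -> X != Y -> x \in X -> x \in Y ->
     X \in [set A; A']) ->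
  exists l, saves (set0 |: E) setT l 2.
Proof.
move=> E0 AE A'E BE vA vA' uA uA' bB nBA nBA' meet.
have nAA' : A != A' by apply: contraNneq uA' => <-.
have BA x : x \in B -> x \notin A.
  move=> xB; apply/negP => xA; have := meet _ _ _ BE AE nBA xB xA.
  by rewrite !inE (negPf nBA) (negPf nBA').
have BA' x : x \in B -> x \notin A'.
  move=> xB; apply/negP => xA; have := meet _ _ _ BE A'E nBA' xB xA.
  by rewrite !inE (negPf nBA) (negPf nBA').
have vB : v \notin B by apply/negP => /BA; rewrite vA.
have uB : u \notin B by apply/negP => /BA; rewrite uA.
pose S := A :|: A' :|: B.
pose G := [set set0; A; A'; B].
(* [(x == v)] is repeated so that [v] gets the value 2. *)
pose l x : nat := (x == v) + (x == v) + (x == u) + (x == b).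
have wl X : set_weight l X = (v \in X) + (v \in X) + (u \in X) + (b \in X).
  by rewrite /set_weight !big_split /= !sum_mem1.
have GS X : X \in G -> X \subset S.
  rewrite !inE -!orbA => /or4P[] /eqP->; rewrite ?sub0set ?subsetUr //.
    by rewrite /S -setUA subsetUl.
  by rewrite /S setUAC subsetUr.
have nz X : X \in E -> X != set0 by move=> XE; apply: contraNneq E0 => <-.
have wtG X : X \in G -> wt l S X = (v \in X) + (v \in X) + (u \in X) + (b \in X).
  by move=> /GS/setIidPl e; rewrite /wt e wl.
(* A hyperedge outside [G] is disjoint from all others by [meet], so it has a vertex outside [S]
   that the other member cannot share. *)
have settledG X Y : (X, Y) \in settled (set0 |: E) S -> X \in G.
  rewrite inE in_setX /= => /andP[/andP[XF YF] /andP[nXY /eqP eXY]].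
  apply: contraT => XG.
  have [nX0 nXA nXA' nXB] : [/\ X != set0, X != A, X != A' & X != B].
    by move: XG; rewrite !inE !negb_or -!andbA => /and4P.
  have XE : X \in E by move: XF; rewrite !inE (negPf nX0).
  have off Z x : Z \in E -> X != Z -> x \in X -> x \notin Z.
    move=> ZE nXZ xX; apply/negP => xZ; have := meet _ _ _ XE ZE nXZ xX xZ.
    by rewrite !inE (negPf nXA) (negPf nXA').
  have /set0Pn[x xX] := nX0.
  have : x \in X :\: S by rewrite !inE xX !negb_or !off.
  rewrite eXY inE => /andP[_ xY].
  have YE : Y \in E.
    by move: YF; rewrite !inE => /predU1P[Y0|//]; rewrite Y0 inE in xY.
  by have := off _ _ YE nXY xX; rewrite xY.
have sl : saves (set0 |: E) S l 2.
  split.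
    move=> X Y XY; have YX : (Y, X) \in settled (set0 |: E) S.
      move: XY; rewrite !inE /= => /andP[/andP[-> ->] /andP[n /eqP->]].
      by rewrite eqxx eq_sym n.
    have XG := settledG _ _ XY; have YG := settledG _ _ YX.
    rewrite !wtG //; move: XY; rewrite inE => /andP[_ /andP[/= + _]].
    move: XG YG; rewrite !inE -!orbA.
    by move=> /or4P[] /eqP-> /or4P[] /eqP->;
      rewrite ?eqxx // ?inE ?vA ?vA' ?uA ?(negPf uA') ?bB ?(negPf vB) ?(negPf uB)
        ?(negPf (BA _ bB)) ?(negPf (BA' _ bB)).
  (* 12 is [2 * (4 + 2)], for weight 4 and saving 2, and also the number of ordered pairs of
     distinct members of [G]. *)
  rewrite wl !inE vA uA bB ?orbT; apply: (@leq_trans 12) => //.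
  have <- : #|[set p in setX G G | p.1 != p.2]| = 12.
    have := card_distinct_pairs G.
    have -> : #|G| = 4.
      rewrite /G setUC cardsU1 setUC cardsU1 cards2 !inE.
      rewrite ![_ == set0]eq_sym in nz *.
      by rewrite !negb_or nBA nBA' ![set0 == _]eq_sym !nz // [A' == A]eq_sym nAA'.
    by move=> e; apply/eqP; rewrite -(eqn_add2r 4) e.
  apply/subset_leq_card/subsetP => -[X Y]; rewrite inE in_setX /=.
  move=> /andP[/andP[XG YG] nXY]; rewrite inE in_setX /= nXY.
  have GF Z : Z \in G -> Z \in set0 |: E.
    by rewrite !inE -!orbA => /or4P[] /eqP->; rewrite ?eqxx ?AE ?A'E ?BE ?orbT.
  have outside Z : Z \in G -> Z :\: S = set0.
    by move=> /GS; rewrite -setD_eq0 => /eqP.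
  by rewrite !GF // !outside // eqxx.
exact: saves_extend sl (subsetT _).
Qed.

(** * Lower bound for pairwise disjoint hyperedges *)

Lemma sum_positive_distinct (T : finType) (G : {set T}) (f : T -> nat) :
  {in G &, injective f} -> (forall x, x \in G -> 0 < f x) ->
  #|G| * #|G|.+1 <= 2 * \sum_(x in G) f x.
Proof.
move=> inj pos.
(* Each value bounds its rank; summing the ranks counts every pair once. *)
have lef x : x \in G -> \sum_(y in G) (f y <= f x) <= f x.
  move=> xG; have -> : \sum_(y in G) (f y <= f x) = #|[set y in G | f y <= f x]|.
    rewrite -sum1_card; under [RHS]eq_bigl do rewrite inE.
    by rewrite big_mkcondr; apply: eq_bigr => y _; case: (f y <= f x).
  rewrite cardE -(size_map f) -[leqRHS](size_iota 1).
  apply: uniq_leq_size.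
    rewrite map_inj_in_uniq ?enum_uniq // => y z; rewrite !mem_enum !inE.
    by move=> /andP[yG _] /andP[zG _]; apply: inj.
  move=> _ /mapP[y + ->]; rewrite mem_enum inE mem_iota => /andP[yG fyx].
  by rewrite pos //= add1n ltnS.
have : \sum_(x in G) \sum_(y in G) (f y <= f x) <= \sum_(x in G) f x.
  by apply: leq_sum => x /lef.
rewrite -(leq_pmul2l (isT : 0 < 2)); apply: leq_trans.
(* With the indices exchanged in one of two copies, each [x] contributes 2 for [y = x] and at least
   1 for every other [y]. *)
rewrite mul2n -addnn {2}exchange_big /= -big_split /=.
rewrite -sum_nat_const; apply: leq_sum => x xG; rewrite -big_split /=.
rewrite -[leqLHS]addn1 -sum1_card (bigD1 x) //= addnAC.
rewrite [leqRHS](bigD1 x) //= leqnn leq_add2l.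
by apply: leq_sum => y _; case: (leqP (f y) (f x)) => // /ltnW->.
Qed.

Lemma omega0_disjoint (H : hypergraph) :
  (forall X Y, X \in edges H -> Y \in edges H -> X != Y -> [disjoint X & Y]) ->
  #|edges H| * #|edges H|.+1 <= 2 * omega0 H.
Proof.
move=> disj; have [l dl <-] := omega0_attained H.
case/andP: dl => /forall_inP pos /forall_inP inj.
apply: (leq_trans (sum_positive_distinct (f := set_weight l) _ pos)).
  move=> X Y XE YE eXY; apply/eqP; apply: contraT => nXY.
  by have := forall_inP (inj X XE) Y YE; rewrite nXY eXY eqxx.
rewrite leq_mul2l /= /weight /set_weight -big_trivIset; last first.
  by apply/trivIsetP.
by rewrite [leqRHS](big_setID (cover (edges H))) /= setTI leq_addr.
Qed.

(** * Case analysis on how the hyperedges meet *)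

Lemma saves_not_disjoint (V : finType) (E : {set {set V}}) (A A' : {set V}) :
  set0 \notin E -> 2 < #|E| -> A \in E -> A' \in E -> A != A' ->
  ~~ [disjoint A & A'] -> exists l, saves (set0 |: E) setT l 2.
Proof.
move=> E0 E3 AE A'E nAA' /pred0Pn[v /andP[/= vA vA']].
pose star x := [set X in E | x \in X].
have starE x X : X \in star x -> X \in set0 |: E.
  by rewrite !inE => /andP[-> _]; rewrite orbT.
have [/existsP[x x3]|/existsPn small] := boolP [exists x, 2 < #|star x|].
  apply: (saves_ge3 (G := star x) (v := x)) => //; rewrite ?inE ?eqxx //.
    by apply/subsetP => X /starE.
  by move=> X; rewrite inE => /andP[].
have star2 x X Y : X \in star x -> Y \in star x -> X != Y -> star x = [set X; Y].
  move=> Xx Yx nXY; apply/esym/eqP; rewrite eqEcard subUset !sub1set Xx Yx /=.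
  by rewrite cards2 nXY leqNgt small.
have vst : star v = [set A; A'] by apply: star2; rewrite ?inE ?AE ?A'E.
have [/existsP[w /and3P[w2 vw wv]]|/existsPn comp] := boolP [exists w,
    [&& 1 < #|star w|, ~~ (star v \subset star w) & ~~ (star w \subset star v)]].
  have other x L : L \in star x -> 1 < #|star x| -> exists2 L', L' \in star x & L' != L.
    move=> Lx; rewrite (cardsD1 L) Lx ltnS => /card_gt0P[L'].
    by rewrite !inE => /andP[nL L'x]; exists L'; rewrite ?inE.
  have v2 : 1 < #|star v| by rewrite vst cards2 nAA'.
  have [L Lv Lw] := subsetPn vw; have [M Mw Mv] := subsetPn wv.
  have [L' L'v nL] := other v L Lv v2; have [M' M'w nM] := other w M Mw w2.
  have [LF L'F] := (starE _ _ Lv, starE _ _ L'v).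
  have [MF M'F] := (starE _ _ Mw, starE _ _ M'w).
  move: Lv Lw Mw Mv L'v M'w; rewrite !inE => /andP[LE vL].
  rewrite LE /= => wL /andP[ME wM]; rewrite ME /= => vM /andP[_ vL'] /andP[_ wM'].
  by apply: (saves_incomparable _ LF L'F MF M'F vL wL); rewrite ?inE ?eqxx.
(* All degrees are now at most 2, and a star of size 2 is comparable with [star v], hence equal to
   it. *)
have meet X Y x : X \in E -> Y \in E -> X != Y -> x \in X -> x \in Y ->
    X \in [set A; A'].
  move=> XE YE nXY xX xY; have Xx : X \in star x by rewrite inE XE.
  have xst : star x = [set X; Y] by apply: star2; rewrite // inE YE.
  have cx : #|star x| = #|star v| by rewrite xst vst !cards2 nXY nAA'.
  rewrite -vst; have := comp x; rewrite cx {1}vst cards2 nAA' /= negb_and !negbK.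
  case/orP=> [vx|/subsetP]; last exact.
  by have /eqP-> : star v == star x by rewrite eqEcard vx cx leqnn.
have /subsetPn[B BE] : ~~ (E \subset [set A; A']).
  by apply: contraL E3 => /subset_leq_card; rewrite cards2 nAA' -leqNgt.
rewrite !inE negb_or => /andP[nBA nBA'].
have /set0Pn[b bB] : B != set0 by apply: contraNneq E0 => <-.
(* As [A] and [A'] differ, one has a vertex outside the other; their roles can be exchanged. *)
have [AA'|/subsetPn[u uA uA']] := boolP (A \subset A'); last first.
  exact: (saves_two_overlapping E0 AE A'E BE vA vA' uA uA' bB).
have /subsetPn[u uA' uA] : ~~ (A' \subset A).
  by apply: contra nAA' => A'A; rewrite eqEsubset AA'.
apply: (saves_two_overlapping E0 A'E AE BE vA' vA uA' uA bB) => // X Y x.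
by rewrite setUC; apply: meet.
Qed.

Theorem theorem1p5 (n : nat) (hn : 3 <= n) :
  ~ exists H : hypergraph,
      #|edges H| = n /\ omega0 H = (n * (n + 1)) %/ 2 - 1.
Proof.
case=> H [cH w]; rewrite -cH addn1 in w hn.
have [/exists_inP[A AE /exists_inP[A' A'E /andP[nAA' meet]]]|/exists_inPn disj] :=
  boolP [exists A in edges H, exists A' in edges H,
          (A != A') && ~~ [disjoint A & A']].
  have [l sl] := saves_not_disjoint (edges_nonempty H) hn AE A'E nAA' meet.
  have := omega0_saves sl; rewrite w; move: #|edges H| => e.
  by move: (e * e.+1) => k; lia.
have := @omega0_disjoint H; rewrite w.
(* At [k = 0] truncated subtraction would make the final inequality true. *)
have k2 : 2 < #|edges H| * #|edges H|.+1 by move: hn; move: #|edges H| => e; nia.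
move: k2; move: (#|edges H| * #|edges H|.+1) => k k2 /(_ _)-le.
suff : k <= 2 * (k %/ 2 - 1) by lia.
apply: le => X Y XE YE nXY; apply: contraT => dXY.
by have /exists_inPn/(_ Y YE) := disj X XE; rewrite nXY dXY.
Qed.
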